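(* Let $n\ge 1$ be an integer and let $AQ_n$ be the $n$-dimensional augmented cube. Its distinguishing number is $$D(AQ_n)=\begin{cases}2 & \text{if } n=1,\\ 4 & \text{if } n=2,\\ 3 & \text{if } n=3,\\ 2 & \text{if } n\ge 4.\end{cases}$$
   Context: The augmented cube $AQ_n$ is a graph whose vertices are the binary strings $a_1\cdots a_n$ with $a_i\in\{0,1\}$, defined recursively. $AQ_1$ is the complete graph $K_2$ on the vertices $0$ and $1$. For $n>1$, take two copies $AQ_{n-1}^0$ and $AQ_{n-1}^1$ of $AQ_{n-1}$, with vertex sets $\{0a_2\cdots a_n : a_i\in\{0,1\}\}$ and $\{1b_2\cdots b_n : b_i\in\{0,1\}\}$ respectively (obtained by prefixing the vertex labels of $AQ_{n-1}$ with $0$, respectively $1$); $AQ_n$ consists of these two copies together with an edge between $0a_2\cdots a_n$ and $1b_2\cdots b_n$ whenever either (1) $a_i=b_i$ for each $2\le i\le n$, or (2) $a_i\neq b_i$ for each $2\le i\le n$. An $r$-coloring of a graph $G$ is any function $c\colon V(G)\to\{1,\dots,r\}$ (not required to be a proper coloring). An automorphism $\pi$ of $G$ preserves $c$ if $c(\pi v)=c(v)$ for every $v\in V(G)$. The coloring $c$ is distinguishing if no nontrivial automorphism of $G$ preserves it. The distinguishing number $D(G)$ is the smallest $r$ such that there exists a distinguishing $r$-coloring of $G$. *)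

(* Defs.v *)
From mathcomp Require Import all_boot all_fingroup.

Set Implicit Arguments.
Unset Strict Implicit.
Unset Printing Implicit Defensive.

Section Distinguishing.

(* A graph is given by its finite vertex type and its adjacency relation. *)
Variables (V : finType) (adj : rel V).

Definition automorphism (p : {perm V}) : bool :=
  [forall x, forall y, adj (p x) (p y) == adj x y].

Definition preserves (r : nat) (p : {perm V}) (c : {ffun V -> 'I_r}) : bool :=
  [forall v, c (p v) == c v].

Definition distinguishing (r : nat) (c : {ffun V -> 'I_r}) : bool :=
  [forall p : {perm V},
     automorphism p && (p != 1%g) ==> ~~ preserves p c].

Definition has_distinguishing_coloring (r : nat) : bool :=
  [exists c : {ffun V -> 'I_r}, distinguishing c].

Lemma ex_distinguishing_coloring : exists r, has_distinguishing_coloring r.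
Proof.
exists #|V|; apply/existsP; exists [ffun v => enum_rank v].
apply/forallP => p; apply/implyP => /andP[_]; apply: contraNN => /forallP pres.
apply/eqP/permP => v; rewrite perm1; apply: enum_rank_inj.
by have := pres v; rewrite !ffunE => /eqP.
Qed.

Definition distinguishing_number : nat := ex_minn ex_distinguishing_coloring.

End Distinguishing.

(* The bit string a_1 ... a_n is the tuple whose head is a_1. The graph is only
   meaningful for n >= 1; the value at n = 0 is a dummy. *)
Fixpoint AQ (n : nat) : rel (n.-tuple bool) :=
  match n return rel (n.-tuple bool) with
  | 0 => fun _ _ => false
  | m.+1 =>
    if m is 0 then fun u v => u != v
    else fun u v =>
      let a := behead_tuple u in
      let b := behead_tuple v in
      if thead u == thead v then @AQ m a b
      else [forall i, tnth a i == tnth b i] || [forall i, tnth a i != tnth b i]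
  end.

Lemma AQ_sym n : symmetric (@AQ n).
Proof.
elim: n => [|[|n] IHn] u v //=; first by rewrite eq_sym.
rewrite [thead v == _]eq_sym; case: ifP => _; first exact: IHn.
by congr (_ || _); apply: eq_forallb => i; rewrite eq_sym.
Qed.

Lemma AQ_irrefl n : irreflexive (@AQ n).
Proof. by elim: n => [|[|n] IHn] u //=; rewrite eqxx //; exact: IHn. Qed.

(* Main.v *)
Require Import Defs.
From mathcomp Require Import all_boot all_fingroup.
From mathcomp Require Import zify.

(** AQ_n is a Cayley graph of (Z/2)^n whose connection set consists of the unit
    vectors and the all-ones suffixes. In the basis of suffixes (a Gray code)
    these are the blocks {i} and {i, i+1}, so AQ_n is the graph on subsets of
    {0, ..., n-1} in which x and y are adjacent when their symmetric difference
    is a block.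

    For n >= 4, colour {}, {0}, {1} and {n-1} with one colour and the rest with
    the other. The first class induces a triangle with a pendant vertex, so a
    colour-preserving automorphism fixes {} and {n-1} and at most swaps {0} and
    {1}. Common neighbours then propagate rigidity: the swap is excluded, all
    blocks are fixed one after the other, then all pairs, and finally larger x,
    which is the only common neighbour of its subsets x \ {i}, x \ {j}, x \ {k}.

    AQ_1 and AQ_2 are complete, and AQ_3 is the join of two copies of 2K_2. In a
    2-colouring of the latter, either some edge is monochromatic and its ends can
    be swapped, or the two edges of one copy can be exchanged. *)

Set Implicit Arguments.
Unset Strict Implicit.
Unset Printing Implicit Defensive.

(** * Distinguishing numbers of arbitrary finite graphs *)

Section GeneralGraphs.

Variables (V : finType) (adj : rel V).

Lemma distinguishingP r (c : {ffun V -> 'I_r}) :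
  reflect (forall p : {perm V}, {mono p : x y / adj x y} ->
             (forall v, c (p v) = c v) -> p =1 id)
          (distinguishing adj c).
Proof.
apply: (iffP forallP) => [dist p autp presp v | dist p].
- have /implyP := dist p; case: (p =P 1%g) => [-> _ | _]; first by rewrite perm1.
  have -> : automorphism adj p.
    by apply/forallP => x; apply/forallP => y; rewrite autp.
  move=> /(_ isT) /negP[]; apply/forallP => w; exact/eqP.
- apply/implyP => /andP[/forallP autp]; apply: contra => /forallP presp.
  apply/eqP/permP => v; rewrite perm1; apply: dist => [x y | w].
    by apply/eqP; have /forallP := autp x.
  exact/eqP.
Qed.

Lemma not_distinguishing r (c : {ffun V -> 'I_r}) (f : V -> V) v0 :
    injective f -> {mono f : x y / adj x y} -> (forall v, c (f v) = c v) ->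
    f v0 != v0 -> ~~ distinguishing adj c.
Proof.
move=> injf autf presf; apply: contraNN => /distinguishingP/(_ (perm injf)) fE.
apply/eqP; rewrite -[LHS](permE injf); apply: fE => [x y | v]; rewrite !permE //.
Qed.

Lemma has_distinguishing_coloringW r s :
  r <= s -> has_distinguishing_coloring adj r -> has_distinguishing_coloring adj s.
Proof.
move=> ler /existsP[c /distinguishingP dist]; apply/existsP.
exists [ffun v => widen_ord ler (c v)]; apply/distinguishingP => p autp presp.
apply: dist => // v; have := presp v; rewrite !ffunE => /(congr1 val) /= cE.
exact: val_inj.
Qed.

(** Having a distinguishing colouring is monotone in the number of colours, so failure at [r]
    excludes all smaller numbers. *)
Lemma distinguishing_numberE r :
    has_distinguishing_coloring adj r.+1 -> ~~ has_distinguishing_coloring adj r ->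
  distinguishing_number adj = r.+1.
Proof.
move=> hasS nhas; rewrite /distinguishing_number; case: ex_minnP => m hasm minm.
apply/eqP; rewrite eqn_leq minm //= ltnNge; apply: contra nhas => lemr.
exact: has_distinguishing_coloringW hasm.
Qed.

(** Every transposition is an automorphism, so a distinguishing colouring must be injective. *)
Lemma distinguishing_number_complete :
  (forall u v, adj u v = (u != v)) -> 0 < #|V| -> distinguishing_number adj = #|V|.
Proof.
move=> adjE; case cardV: #|V| => [|m] // _; apply: distinguishing_numberE.
- apply/existsP; exists [ffun v => cast_ord cardV (enum_rank v)].
  apply/distinguishingP => p _ presp v; have := presp v.
  by rewrite !ffunE => /cast_ord_inj/enum_rank_inj.
- apply/existsPn => c.
  have /injectivePn[x [y neqxy cxy]] : ~~ injectiveb c.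
    apply/injectiveP => /leq_card; rewrite card_ord cardV; lia.
  apply: (@not_distinguishing _ _ (tperm x y) x).
  + exact: perm_inj.
  + by move=> u v; rewrite !adjE (inj_eq perm_inj).
  + by move=> v; case: tpermP => // ->.
  + by rewrite tpermL eq_sym.
Qed.

End GeneralGraphs.

Lemma has_distinguishing_coloring_iso (V W : finType) (e : rel V) (e' : rel W)
    (f : V -> W) (g : W -> V) r :
    cancel f g -> cancel g f -> {mono f : x y / e x y >-> e' x y} ->
  has_distinguishing_coloring e' r -> has_distinguishing_coloring e r.
Proof.
move=> fK gK ef /existsP[c /distinguishingP dist]; apply/existsP.
exists [ffun v => c (f v)]; apply/distinguishingP => p autp presp v.
have injq : injective (f \o p \o g).
  by apply: inj_comp (can_inj gK); apply: inj_comp (can_inj fK) perm_inj.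
have := dist (perm injq) _ _ (f v); rewrite permE /= fK => qE.
apply: (can_inj fK); apply: qE => [x y | w]; rewrite !permE /=.
  by rewrite ef autp -ef !gK.
by have := presp (g w); rewrite !ffunE gK.
Qed.

Lemma distinguishing_number_iso (V W : finType) (e : rel V) (e' : rel W)
    (f : V -> W) :
    bijective f -> {mono f : x y / e x y >-> e' x y} ->
  distinguishing_number e = distinguishing_number e'.
Proof.
case=> g fK gK ef; apply: eq_ex_minn => r; apply/idP/idP.
  by apply: (has_distinguishing_coloring_iso gK fK) => x y; rewrite -ef !gK.
exact: (has_distinguishing_coloring_iso fK gK).
Qed.

(** * Subset model of the augmented cube in Gray-code coordinates *)

Section SymmetricDifference.

Variable T : finType.
Implicit Types x y z : {set T}.

Definition symdiff x y := [set a | (a \in x) (+) (a \in y)].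

Lemma in_symdiff a x y : (a \in symdiff x y) = (a \in x) (+) (a \in y).
Proof. by rewrite inE. Qed.

Lemma symdiffC x y : symdiff x y = symdiff y x.
Proof. by apply/setP => a; rewrite !in_symdiff addbC. Qed.

Lemma symdiff0 x : symdiff set0 x = x.
Proof. by apply/setP => a; rewrite in_symdiff inE. Qed.

End SymmetricDifference.

Section AugmentedCube.

Variable n : nat.
Implicit Types (i j k : 'I_n) (d x y : {set 'I_n}).

Definition block d := [exists i : 'I_n, exists j : 'I_n, (i <= j <= i.+1) && (d == [set i; j])].

Lemma blockP d :
  reflect (exists i j : 'I_n, i <= j <= i.+1 /\ d = [set i; j]) (block d).
Proof.
apply: (iffP existsP) => -[i].
  by case/existsP => j /andP[ij /eqP->]; exists i, j.
by case=> j [ij ->]; exists i; apply/existsP; exists j; rewrite ij eqxx.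
Qed.

Definition block_adj x y := block (symdiff x y).

(** Positions where the string changes, with a [false] placed before its first bit. Flipping the
    suffix from [i] toggles position [i] only; flipping bit [i] alone also toggles [i.+1], if that
    position exists. *)
Definition gray (u : n.-tuple bool) : {set 'I_n} :=
  [set i : 'I_n | nth false u i (+) nth false (false :: u) i].

Lemma gray_inj : injective gray.
Proof.
move=> u v /setP guv; apply: val_inj; apply: (@eq_from_nth _ false).
  by rewrite !size_tuple.
rewrite size_tuple; elim=> [|k IHk] ltkn; have := guv (Ordinal ltkn).
  by rewrite !inE /= !addbF.
by rewrite !inE /= IHk; [move/addIb | exact: ltnW].
Qed.

Lemma gray_bij : bijective gray.
Proof.
apply: inj_card_bij gray_inj _.
by rewrite card_tuple card_bool -cardsT -powersetT card_powerset cardsT card_ord.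
Qed.

End AugmentedCube.

Lemma AQ_cons n a b (u v : n.+1.-tuple bool) :
  AQ [tuple of a :: u] [tuple of b :: v] =
    if a == b then AQ u v else (u == v) || (u == map_tuple negb v).
Proof.
have beheadK c (t : n.+1.-tuple bool) : behead_tuple [tuple of c :: t] = t.
  exact: val_inj.
rewrite /= !theadE !beheadK; congr (if _ then _ else _ || _).
  by apply/forallP/eqP => [uv | -> //]; apply: eq_from_tnth => i; apply/eqP.
apply/forallP/eqP => [uv | -> i]; last by rewrite tnth_map; case: (tnth v i).
by apply: eq_from_tnth => i; have := uv i; rewrite tnth_map; case: (tnth u i); case: (tnth v i).
Qed.

(** The recursion unfolds into the Cayley description: edges between the two halves give [i = 0],
    those inside a half come from the smaller cube with [i] shifted by one. *)
Lemma AQP n (u v : n.-tuple bool) :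
  let w k := nth false u k (+) nth false v k in
  reflect (exists2 i, i < n & (forall k, k < n -> w k = (k == i))
                           \/ (forall k, k < n -> w k = (i <= k)))
          (AQ u v).
Proof.
elim: n u v => [|[|n] IHn] u v w; first by right=> -[].
- case/tupleP: u @w => a u; case/tupleP: v => b v w; rewrite /= (tuple0 u) (tuple0 v).
  apply: (iffP idP) => [neqab | [[]// _ wE]].
    exists 0 => //; left => -[|] //= _; rewrite /w /=.
    by move: neqab; case: a {w}; case: b.
  have {}wE : w 0 = true by case: wE => ->.
  by move: wE; rewrite /w /=; case: a {w}; case: b.
case/tupleP: u @w => a u; case/tupleP: v => b v w.
rewrite AQ_cons; case: eqP => [eqab | /eqP neqab].
- apply: (iffP (IHn u v)) => [[i ltin wE] | [[|i] ltin wE]].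
  + exists i.+1; first by [].
    by case: wE => wE; [left | right] => -[|k] ltkn; rewrite /w /= ?eqab ?addbb // wE.
  + by have : w 0 = true; [case: wE => -> | rewrite /w /= eqab addbb].
  + exists i; first by [].
    by case: wE => wE; [left | right] => k ltkn; have := wE k.+1 ltkn.
have w0 : w 0 = true by rewrite /w /=; move: neqab; case: (a); case: (b).
apply: (iffP orP) => [[] /eqP uv | [[|i] ltin wE]].
- by exists 0 => //; left => -[|k] ltkn //=; rewrite /w /= uv addbb.
- exists 0 => //; right => -[|k] ltkn //=.
  by rewrite /w /= uv (nth_map false) ?size_tuple //; case: nth.
- case: wE => wE; [left | right]; apply/eqP/eq_from_tnth => k;
  have := wE (val k).+1 (ltn_ord k); rewrite /w /= ?tnth_map !(tnth_nth false);
  by case: nth; case: nth.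
- by case: wE => wE; move: w0; rewrite wE.
Qed.

Lemma gray_block_adj n : {mono @gray n : u v / AQ u v >-> block_adj u v}.
Proof.
move=> u v; set w := fun k => nth false u k (+) nth false v k.
(* The difference of the Gray codes is the discrete derivative of [w] modulo 2, with value [false]
   before position 0. *)
have dE (i : 'I_n) : (i \in symdiff (gray u) (gray v)) = w i (+) ((0 < i) && w i.-1).
  rewrite !inE /w; case: i => -[|i] ltin /=; first by rewrite !addbF.
  by do 4 case: nth.
apply/blockP/AQP => [[i [j [ij defd]]] | [i ltin wE]].
- exists i => //; have {}dE k (ltkn : k < n) :
      w k (+) ((0 < k) && w k.-1) = (k == i) || (k == j).
    by rewrite -(dE (Ordinal ltkn)) defd !inE.
  (* Summing back from the left: a singleton gives the suffix from [i], a consecutive pair gives the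
     unit vector at [i]. *)
  have [eqij | neqij] := eqVneq i j; [right | left] => k; rewrite -/(w k); elim: k => [|k IHk] ltkn;
    have := dE _ ltkn; rewrite /= ?addbF => //.
  + by move=> ->; rewrite -eqij; lia.
  + by rewrite IHk -?eqij; [case: (w _) => /=; lia | lia].
  + by move=> ->; have : (i : nat) != j by []; lia.
  + rewrite IHk; last by lia.
    have : (i : nat) != j by [].
    by case: (w _) => /=; lia.
- have {}wE : (forall k, k < n -> w k = (k == i)) \/ (forall k, k < n -> w k = (i <= k)).
    exact: wE.
  case: wE => wE; last first.
    exists (Ordinal ltin), (Ordinal ltin); split; first by (rewrite /=; lia).
    apply/setP => k; rewrite dE !inE -!val_eqE /= !wE //; last by have := ltn_ord k; lia.
    by lia.
  case: (ltnP i.+1 n) => [ltiSn | leni].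
    exists (Ordinal ltin), (Ordinal ltiSn); split; first by (rewrite /=; lia).
    apply/setP => k; rewrite dE !inE -!val_eqE /= !wE //; last by have := ltn_ord k; lia.
    by lia.
  (* The unit vector at the last position is itself a suffix, hence a singleton block. *)
  exists (Ordinal ltin), (Ordinal ltin); split; first by (rewrite /=; lia).
  apply/setP => k; rewrite dE !inE -!val_eqE /= !wE //; last by have := ltn_ord k; lia.
  by have := ltn_ord k; lia.
Qed.

(** * Rigidity of the block graph *)

(** Inside the triangle [a], [b], [c] with pendant [d] at [a] the degrees are 3, 2, 2, 1, which
    singles out [a] and [d]. *)
Lemma paw_rigid (T : Type) (adj : rel T) (p : T -> T) (a b c d : T) :
    symmetric adj -> irreflexive adj -> injective p -> {mono p : x y / adj x y} ->
    [/\ adj a b, adj a c, adj a d, adj b c & ~~ adj b d && ~~ adj c d] ->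
    (forall x, [\/ x = a, x = b, x = c | x = d] ->
               [\/ p x = a, p x = b, p x = c | p x = d]) ->
  [/\ p a = a, p d = d & (p b = b /\ p c = c) \/ (p b = c /\ p c = b)].
Proof.
move=> adjC adjxx injp autp [ab ac ad bc /andP[/negPf bd /negPf cd]] stab.
(* Images of adjacent vertices differ by irreflexivity; only the two non-adjacent pairs need
   injectivity. *)
have nbd : p b <> p d by move/injp => e; move: bc cd; rewrite adjC e => ->.
have ncd : p c <> p d by move/injp => e; move: bc bd; rewrite e => ->.
have := (adjC b a, adjC c a, adjC d a, adjC c b, adjC d b, adjC d c).
have := (adjxx a, adjxx b, adjxx c, adjxx d).
have := (autp a b, autp a c, autp a d, autp b c, autp b d, autp c d).
rewrite ab ac ad bc bd cd => -[[[[[pab pac] pad] pbc] pbd] pcd] [[[aa bb] cc] dd].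
case=> [[[[[ba ca] da] cb] db] dc].
have := stab a (Or41 _ _ _ erefl); have := stab b (Or42 _ _ _ erefl).
have := stab c (Or43 _ _ _ erefl); have := stab d (Or44 _ _ _ erefl).
clear injp autp stab adjC adjxx.
case=> pd; rewrite pd in pad pbd pcd nbd ncd; case=> pc; rewrite pc in pac pbc pcd ncd;
  try congruence; case=> pb; rewrite pb in pab pbc pbd nbd; try congruence;
  case=> pa; rewrite pa in pab pac pad; try congruence.
all: by split=> //; (by left) || (by right).
Qed.

Section Rigidity.

Variable n : nat.
Implicit Types (i j k l m a b c : 'I_n) (d x y : {set 'I_n}).

Lemma block1 i : block [set i].
Proof. by apply/blockP; exists i, i; rewrite setUid; split=> //; lia. Qed.

Lemma block2 i j : i <= j <= i.+1 -> block [set i; j].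
Proof. by move=> ij; apply/blockP; exists i, j. Qed.

Lemma block_neq0 d : block d -> exists a, a \in d.
Proof. by case/blockP => i [j [_ ->]]; exists i; rewrite !inE eqxx. Qed.

Lemma block_near d a b : block d -> a \in d -> b \in d -> a <= b.+1.
Proof.
case/blockP => i [j [ij ->]]; rewrite !inE.
by case/orP => /eqP-> /orP[] /eqP->; lia.
Qed.

Lemma block_adjC x y : block_adj x y = block_adj y x.
Proof. by rewrite /block_adj symdiffC. Qed.

Lemma block_adjxx x : block_adj x x = false.
Proof.
by case adjxx: block_adj => //; have [a] := block_neq0 adjxx; rewrite in_symdiff addbb.
Qed.

Lemma block_adj0 x : block_adj set0 x = block x.
Proof. by rewrite /block_adj symdiff0. Qed.

(** Used in both orders, this makes any two positions where adjacent sets differ equal or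
    consecutive; the common-neighbour lemmas pass such bounds to [lia]. *)
Lemma block_adj_near x y a b : block_adj x y ->
  (a \in x) (+) (a \in y) -> (b \in x) (+) (b \in y) -> a <= b.+1.
Proof. by move=> adjxy; rewrite -!in_symdiff; exact: block_near. Qed.

Lemma block_adj1 i j : block_adj [set i] [set j] = (i != j) && (i <= j.+1) && (j <= i.+1).
Proof.
apply/idP/idP => [adjij | /andP[/andP[neqij leij] leji]].
  have neqij : i != j by apply: contraTneq adjij => ->; rewrite block_adjxx.
  have near a b := block_adj_near (a := a) (b := b) adjij.
  by rewrite neqij !near // !inE ?eqxx ?(negPf neqij) // eq_sym (negPf neqij).
wlog leqij : i j neqij leij leji / i <= j.
  move=> IH; case: (leqP i j) => [|/ltnW] le; first exact: IH.
  by rewrite block_adjC IH // eq_sym.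
rewrite /block_adj; have -> : symdiff [set i] [set j] = [set i; j].
  apply/setP => k; rewrite !inE; case: eqP => [->|] //=.
by apply: block2; rewrite leqij.
Qed.

(** Blocks are the neighbours of [set0], so [y] is a common neighbour of [set0] and [[set i]]. There
    are at most four of these, and at most two when [i] is an end of the range. *)
Lemma common_nbr1 i y : block y -> block_adj y [set i] ->
  exists2 j : 'I_n, (j == i.+1 :> nat) || (i == j.+1 :> nat) & y = [set j] \/ y = [set i; j].
Proof.
case/blockP => a [b [ab ->]] adjy.
have near k l := block_adj_near (a := k) (b := l) adjy.
have := near i a; have := near i b; have := near a i; have := near b i.
have := near a b; have := near b a.
rewrite !inE !eqxx /= !orbT -!val_eqE /= => h1 h2 h3 h4 h5 h6.
have neq : ~ (i = a :> nat /\ i = b :> nat).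
  case=> /val_inj ia /val_inj ib; move: adjy.
  by rewrite -ia -ib setUid block_adjxx.
case: (eqVneq i a) => [eqia | neqia].
  subst a; exists b; [by move: neq; lia | by right].
case: (eqVneq i b) => [eqib | neqib].
  subst b; exists a; [by move: neqia; rewrite -val_eqE /=; lia | by right; rewrite setUC].
have /val_inj eqab : a = b :> nat by move: neqia neqib; rewrite -!val_eqE /=; lia.
subst b; rewrite setUid; exists a; last by left.
by move: neqia; rewrite -!val_eqE /=; lia.
Qed.

Lemma common_nbr2 i j y : j = i.+1 :> nat -> block y -> block_adj y [set i; j] ->
  y = [set i] \/ y = [set j].
Proof.
move=> jE /blockP[a [b [ab ->]]] adjy.
have near k l := block_adj_near (a := k) (b := l) adjy.
have neq : ~ (a = i :> nat /\ b = j :> nat).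
  by case=> /val_inj ia /val_inj ib; move: adjy; rewrite -ia -ib block_adjxx.
have : (a = i :> nat /\ b = i :> nat) \/ (a = j :> nat /\ b = j :> nat).
  have := near a i; have := near a j; have := near b i; have := near b j.
  have := near i a; have := near j a; have := near i b; have := near j b.
  have := near i j; have := near j i.
  have neqij : (i == j) = false by rewrite -val_eqE /=; lia.
  rewrite !inE !eqxx !orbT ![i == a]eq_sym ![i == b]eq_sym ![j == a]eq_sym ![j == b]eq_sym.
  rewrite ?neqij ?[j == i]eq_sym ?neqij.
  case ai: (a == i); case aj: (a == j); case bi: (b == i); case bj: (b == j);
    by rewrite /=; move: neq ai aj bi bj; rewrite -!val_eqE /=; lia.
by case=> -[/val_inj-> /val_inj->]; rewrite setUid; [left | right].
Qed.

Lemma common_nbr_far i j y : i.+2 < j ->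
    block_adj y [set i] -> block_adj y [set j] -> y = set0 \/ y = [set i; j].
Proof.
move=> ltij adji adjj.
have near1 k l := block_adj_near (a := k) (b := l) adji.
have near2 k l := block_adj_near (a := k) (b := l) adjj.
have mem k : (k \in y) = ((k == i) || (k == j)) && (i \in y) /\ (i \in y) = (j \in y).
  have := near1 i j; have := near1 j i; have := near2 i j; have := near2 j i.
  rewrite !inE -!val_eqE /= !eqxx.
  have [-> | neqki] := eqVneq k i; first by rewrite eqxx; lia.
  have [-> | neqkj] := eqVneq k j; first by rewrite eqxx; lia.
  have := near1 k i; have := near1 k j; have := near1 i k; have := near1 j k.
  have := near2 k i; have := near2 k j; have := near2 i k; have := near2 j k.
  move: neqki neqkj; rewrite !inE -!val_eqE /= !eqxx.
  by lia.
case yi: (i \in y); [right | left]; apply/setP => k; rewrite !inE (mem k).1 yi.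
  by rewrite andbT.
by rewrite andbF.
Qed.

(** At distance exactly two the middle element [m] is next to both [i] and [j], so it may be added
    to either solution of the far case. *)
Lemma common_nbr_gap i m j y : m = i.+1 :> nat -> j = m.+1 :> nat ->
    block_adj y [set i] -> block_adj y [set j] ->
  [\/ y = set0, y = [set m], y = [set i; j] | y = m |: [set i; j]].
Proof.
move=> mE jE adji adjj.
have near1 k l := block_adj_near (a := k) (b := l) adji.
have near2 k l := block_adj_near (a := k) (b := l) adjj.
have memij : (j \in y) = (i \in y).
  have := near1 i j; have := near1 j i; have := near2 i j; have := near2 j i.
  by rewrite !inE -!val_eqE /= !eqxx; lia.
have mem k : k != m -> (k \in y) = ((k == i) || (k == j)) && (i \in y).
  move=> neqkm; have [-> // | neqki] := eqVneq k i.
  have [-> | neqkj] := eqVneq k j; first by rewrite memij orbT.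
  have := near1 k i; have := near1 k j; have := near1 i k; have := near1 j k.
  have := near2 k i; have := near2 k j; have := near2 i k; have := near2 j k.
  move: neqki neqkj neqkm; rewrite !inE -!val_eqE /= !eqxx memij.
  by lia.
have [nmi nmj] : (m == i) = false /\ (m == j) = false by rewrite -!val_eqE /=; lia.
case yi: (i \in y) mem; case ym: (m \in y) => mem.
all: [> apply: Or44 | apply: Or43 | apply: Or42 | apply: Or41]; apply/setP => k;
  rewrite !inE; have [-> | /mem->] := eqVneq k m; by rewrite ?ym ?nmi ?nmj ?andbT ?andbF.
Qed.

Lemma common_nbr3 i j k x y : i < j -> j < k ->
    block_adj y (symdiff x [set i]) -> block_adj y (symdiff x [set j]) ->
    block_adj y (symdiff x [set k]) ->
  y = x.
Proof.
move=> ltij ltjk adji adjj adjk.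
have near1 a b := block_adj_near (a := a) (b := b) adji.
have near2 a b := block_adj_near (a := a) (b := b) adjj.
have near3 a b := block_adj_near (a := a) (b := b) adjk.
have [c] := block_neq0 adjj; rewrite !inE => dc.
apply/setP => a; apply/eqP; rewrite -[_ == _]negbK negb_eqb; apply/negP.
have [neqij neqjk] : (i == j) = false /\ (j == k) = false by rewrite -!val_eqE /=; lia.
(* [w] is the indicator of [symdiff y x], supposed to contain [a]; toggling [i], [j] or [k] in it
   yields a block. *)
set w := fun b => (b \in y) (+) (b \in x).
have wE b e : (b \in y) (+) ((b \in x) (+) e) = w b (+) e by rewrite addbA.
have W1 b b' : w b (+) (b == i) -> w b' (+) (b' == i) -> b <= b'.+1.
  by have := near1 b b'; rewrite !inE !wE.
have W2 b b' : w b (+) (b == j) -> w b' (+) (b' == j) -> b <= b'.+1.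
  by have := near2 b b'; rewrite !inE !wE.
have W3 b b' : w b (+) (b == k) -> w b' (+) (b' == k) -> b <= b'.+1.
  by have := near3 b b'; rewrite !inE !wE.
rewrite wE in dc; rewrite -/(w a) => wa.
(* Otherwise [a] lies above or below [j], hence at distance at least two from [i] or from [k]. That
   end shares with [a] the block for [j] if [w] contains it, and its own block if not. *)
have wj : w j.
  apply: contraT => nwj.
  have neqaj : (a == j) = false by apply: contraNF nwj => /eqP <-.
  have leaj : a <= j.+1 by apply: W2; rewrite ?wa ?(negPf nwj) ?neqaj ?eqxx.
  have leja : j <= a.+1 by apply: W2; rewrite ?wa ?(negPf nwj) ?neqaj ?eqxx.
  have neqaj' : (a : nat) != j by rewrite val_eqE neqaj.
  have [ltja | leaj'] := ltnP j a.
    have neqai : (a == i) = false by rewrite -val_eqE /=; clear -ltja ltij; lia.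
    have [wi | nwi] := boolP (w i).
      by have := W2 a i; rewrite wa wi neqaj neqij => /(_ isT isT); clear -ltja ltij; lia.
    by have := W1 a i; rewrite wa (negPf nwi) neqai eqxx => /(_ isT isT); clear -ltja ltij; lia.
  have ltaj : a < j by rewrite ltn_neqAle neqaj'.
  have neqak : (a == k) = false by rewrite -val_eqE /=; clear -ltaj ltjk; lia.
  have [wk | nwk] := boolP (w k).
    by have := W2 k a; rewrite wa wk neqaj eq_sym neqjk => /(_ isT isT); clear -ltaj ltjk; lia.
  by have := W3 k a; rewrite wa (negPf nwk) neqak eqxx => /(_ isT isT); clear -ltaj ltjk; lia.
have neqcj : (c == j) = false by apply: contraTF dc => /eqP->; rewrite wj eqxx.
have wc : w c by move: dc; rewrite neqcj addbF.
(* If [w] contained [i], then [i] and [k], at distance at least two, would share the block for [j]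
   or the one for [k]. *)
have [wi | nwi] := boolP (w i).
  have [wk | nwk] := boolP (w k).
    by have := W2 k i; rewrite wi wk neqij eq_sym neqjk => /(_ isT isT); clear -ltij ltjk; lia.
  have neqik : (i == k) = false by rewrite -val_eqE /=; clear -ltij ltjk; lia.
  by have := W3 k i; rewrite wi (negPf nwk) neqik eqxx => /(_ isT isT); clear -ltij ltjk; lia.
(* Now the block for [i] contains the three distinct elements [i], [j] and [c], which cannot be
   pairwise within distance one. *)
have neqci : (c == i) = false by apply: contraNF nwi => /eqP <-.
have Wi b : w b -> (b == i) = false -> b <= i.+1 /\ i <= b.+1.
  by move=> wb neqbi; split; apply: W1; rewrite ?wb ?neqbi ?(negPf nwi) ?eqxx.
have neqji : (j == i) = false by rewrite eq_sym.
have := Wi c wc neqci; have := Wi j wj neqji.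
have := W1 j c; rewrite wc wj neqci neqji => /(_ isT isT).
by move: neqci neqcj; rewrite -!val_eqE /=; clear -ltij; lia.
Qed.

Lemma symdiffK x y : symdiff x (symdiff x y) = y.
Proof. by apply/setP => a; rewrite !in_symdiff addbA addbb. Qed.

Lemma block_adj_symdiff x y : block_adj x (symdiff x y) = block y.
Proof. by rewrite /block_adj symdiffK. Qed.

Lemma block_adj21 i j : i != j -> block_adj [set i; j] [set i].
Proof.
move=> neqij; have {2}-> : [set i] = symdiff [set i; j] [set j].
  by apply/setP => k; rewrite !inE; case: eqP => [->|]; rewrite ?(negPf neqij) ?addbb.
by rewrite block_adj_symdiff block1.
Qed.

Section FixedBlocks.

Variable p : {set 'I_n} -> {set 'I_n}.
Hypotheses (injp : injective p) (autp : {mono p : x y / block_adj x y}).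
Hypothesis p0 : p set0 = set0.

Lemma block_image x : block (p x) = block x.
Proof. by rewrite -[RHS]block_adj0 -autp p0 block_adj0. Qed.

(** The only common neighbours of [set0] and [[set o0]] are [[set o1]] and [[set o0; o1]]. Under a
    swap the first is the image of [[set o0]], so [[set o2]] and [[set o1; o2]] would both go to the
    second. *)
Lemma no_swap (o0 o1 o2 : 'I_n) : [/\ o0 = 0 :> nat, o1 = 1 :> nat & o2 = 2 :> nat] ->
  p [set o0] = [set o1] -> p [set o1] <> [set o0].
Proof.
case=> e0 e1 e2 p01 p10.
have neq01 : o0 != o1 by rewrite -val_eqE /= e0 e1.
have neq12 : o1 != o2 by rewrite -val_eqE /= e1 e2.
have neq02 : o0 != o2 by rewrite -val_eqE /= e0 e2.
have py y : block y -> block_adj y [set o1] -> y != [set o0] -> p y = [set o0; o1].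
  rewrite -block_image -autp p10 => blocky adjy neqy.
  have [j jE] := common_nbr1 blocky adjy.
  have -> : j = o1 by apply: val_inj; rewrite /= e1; lia.
  by case=> // pyE; rewrite -p01 in pyE; rewrite (injp pyE) eqxx in neqy.
have p2 : p [set o2] = [set o0; o1].
  apply: py; rewrite ?block1 ?(inj_eq set1_inj) 1?eq_sym ?neq02 //.
  by rewrite block_adj1 eq_sym neq12 e1 e2.
have p12 : p [set o1; o2] = [set o0; o1].
  apply: py; rewrite ?block_adj21 //; first by apply: block2; rewrite e1 e2.
  by apply: contraNneq neq02 => e; have := set22 o1 o2; rewrite e inE eq_sym.
have /injp/setP/(_ o1) : p [set o2] = p [set o1; o2] by rewrite p2 p12.
by rewrite !inE eqxx (negPf neq12).
Qed.

(** Induction from the left: once the blocks inside 0, ..., k are fixed, the only freedom among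
    common neighbours of [set0] and {k} is to exchange {k+1} with {k, k+1}. *)
Lemma block_fixed (o0 oL : 'I_n) x : o0 = 0 :> nat -> oL.+1 = n ->
  p [set o0] = [set o0] -> p [set oL] = [set oL] -> block x -> p x = x.
Proof.
move=> e0 eL f0 fL.
suff fixed (k : nat) i : i <= k -> p [set i] = [set i] /\
    forall j, j = i.+1 :> nat -> j <= k -> p [set i; j] = [set i; j].
  case/blockP=> i [j [ij ->]]; have [] := fixed n i (ltnW (ltn_ord i)).
  have [<- | neqij fi fij] := eqVneq i j; first by rewrite setUid.
  by apply: fij (ltnW (ltn_ord j)); move: neqij; rewrite -val_eqE /=; lia.
elim: k i => [i|k IHk].
  rewrite leqn0 => /eqP i0; have -> : i = o0 by apply: val_inj; rewrite /= e0.
  by split=> // j jE; rewrite jE.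
have last (i j : 'I_n) : i = k :> nat -> j = k.+1 :> nat ->
    p [set j] = [set j] /\ p [set i; j] = [set i; j].
  move=> ik jk; have [fi _] := IHk i (eq_leq ik).
  have neqij : i != j by rewrite -val_eqE /= ik jk neq_ltn ltnSn.
  (* The subset condition keeps [y] away from [[set l]] and [[set i; l]] with [l] just below [i],
     which are already fixed. *)
  have py y : block y -> block_adj y [set i] ->
      (forall l : 'I_n, l = k :> nat \/ l.+1 = k -> ~~ (y \subset [set i; l])) ->
      p y = [set j] \/ p y = [set i; j].
    rewrite -block_image -autp fi => blocky adjy neqy.
    have [l lE pyE] := common_nbr1 blocky adjy.
    have [-> // | neqlj] := eqVneq j l.
    have li : i = l.+1 :> nat by move: neqlj; rewrite -val_eqE /=; lia.
    have [fl fli] : _ /\ _ := IHk l (ltac:(lia)); case: pyE => pyE.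
      rewrite -fl in pyE; have := neqy l; rewrite (injp pyE) subsetUr; lia.
    rewrite setUC -(fli i) // in pyE; last by lia.
    have := neqy l; rewrite (injp pyE) setUC subxx; lia.
  have pj : p [set j] = [set j] \/ p [set j] = [set i; j].
    apply: py; rewrite ?block1 ?block_adj1 //; first by rewrite eq_sym neqij; lia.
    move=> l lE; rewrite sub1set !inE -!val_eqE /=; lia.
  have pij : p [set i; j] = [set j] \/ p [set i; j] = [set i; j].
    apply: py; rewrite ?block_adj21 //; first by apply: block2; lia.
    move=> l lE; apply/subsetPn; exists j; rewrite !inE -!val_eqE /=; lia.
  have neq : [set j] <> [set i; j].
    by move/setP/(_ i); rewrite !inE eqxx (negPf neqij).
  suff fj : p [set j] = [set j].
    by split=> //; case: pij => //; rewrite -{2}fj => /injp /esym.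
  case: pj => // pj; exfalso.
  have {}pij : p [set i; j] = [set j] by case: pij => //; rewrite -{2}pj => /injp /esym.
  (* At the right end the exchange contradicts [fL]. Elsewhere {k+2} is adjacent to {k+1}, so its
     image is a block adjacent to {k, k+1}, that is {k} or {k+1}; both are already images of other
     sets. *)
  have ltjn : k.+2 < n.
    suff : k.+2 != n by have := ltn_ord j; rewrite jk; clear; lia.
    apply/eqP => kn; have jL : j = oL by apply: val_inj => /=; lia.
    by rewrite jL fL -jL in pj.
  set l := Ordinal ltjn.
  have neqjl : l != j by rewrite -val_eqE /= jk; lia.
  have blockl : block (p [set l]) by rewrite block_image block1.
  have adjl : block_adj (p [set l]) [set i; j].
    by rewrite -pj autp block_adj1 neqjl /=; lia.
  have jSi : j = i.+1 :> nat by rewrite ik.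
  have [pl | pl] := common_nbr2 jSi blockl adjl.
    rewrite -fi in pl; have /set1_inj/(congr1 val) /= := injp pl; lia.
  by rewrite -pij in pl; have /setP/(_ j) := injp pl; rewrite !inE eqxx orbT eq_sym (negPf neqjl).
move=> i; rewrite leq_eqVlt ltnS => /orP[/eqP ik | leik]; last first.
  have [fi fij] := IHk i leik; split=> // j jE; rewrite leq_eqVlt ltnS => /orP[/eqP jk |].
    have ik : i = k :> nat by rewrite jE in jk; case: jk.
    by have [] := last i j ik jk.
  exact: fij.
have ltkn : k < n by rewrite (ltn_trans _ (ltn_ord i)) // ik.
split=> [|j ->]; last by rewrite ik ltnn.
by have [] := last (Ordinal ltkn) i erefl ik.
Qed.

Hypothesis (lt3n : 3 < n) (fixb : forall x, block x -> p x = x).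

Lemma fixed_image_adj x y : block x -> block_adj (p y) x = block_adj y x.
Proof. by move=> bx; rewrite -{1}(fixb bx) autp. Qed.

Lemma pair_fixed i j : i < j -> p [set i; j] = [set i; j].
Proof.
have nset0 (a b : 'I_n) : p [set a; b] <> set0.
  by rewrite -p0 => /injp/setP/(_ a); rewrite !inE eqxx.
have adj_image a b : a < b -> block_adj (p [set a; b]) [set a] /\ block_adj (p [set a; b]) [set b].
  move=> ltab; have neqab : a != b by rewrite -val_eqE /= ltn_eqF.
  rewrite !fixed_image_adj ?block1 // block_adj21 // setUC block_adj21 //.
  by rewrite eq_sym.
have far a b : a.+2 < b -> p [set a; b] = [set a; b].
  move=> ltab; have [|adja adjb] := adj_image a b; first by lia.
  by case: (common_nbr_far ltab adja adjb) => // /nset0.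
move=> ltij; have [adji adjj] := adj_image _ _ ltij.
have [leji | ltSij] := leqP j i.+1; first by apply/fixb/block2; lia.
have [leji | /far//] := leqP j i.+2.
have ltmn : i.+1 < n by rewrite (ltn_trans ltSij).
pose m := Ordinal ltmn.
have jE : j = m.+1 :> nat by rewrite /=; lia.
case: (common_nbr_gap (erefl : m = i.+1 :> nat) jE adji adjj) => // pE.
- by case: (nset0 i j).
- have /setP/(_ m) : [set i; j] = [set m] by apply: injp; rewrite pE fixb ?block1.
  by rewrite !inE eqxx -!val_eqE /=; lia.
(* To exclude the triple, take a fixed far pair adjacent to [[set i; j]] but not to the triple: move
   [j] up by one if possible, otherwise move [i] down. *)
exfalso; have [ltjn | lejn] := ltnP j.+1 n.
  pose l := Ordinal ltjn.
  have adjl : block_adj [set i; j] [set i; l].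
    rewrite /block_adj; have -> : symdiff [set i; j] [set i; l] = [set j; l].
      apply/setP => k; rewrite !inE; have [->|_] := eqVneq k i.
        by rewrite -!val_eqE /=; lia.
      by rewrite /=; have [->|//] := eqVneq k j; rewrite -!val_eqE /=; lia.
    by apply: block2; rewrite /=; lia.
  rewrite -autp pE (far i l) in adjl; last by rewrite /=; lia.
  have := block_adj_near (a := l) (b := m) adjl; rewrite !inE -!val_eqE /= !eqxx.
  by clear -jE ltij; simpl in *; lia.
(* Here [j] is the last index, and [3 < n] makes [i] positive, so [i.-1] is a genuine
   predecessor. *)
have lti1n : i.-1 < n by rewrite (leq_ltn_trans (leq_pred i)).
pose l := Ordinal lti1n.
have adjl : block_adj [set i; j] [set l; j].
  rewrite /block_adj; have -> : symdiff [set i; j] [set l; j] = [set l; i].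
    apply/setP => k; rewrite !inE; have [->|_] := eqVneq k j.
      by rewrite -!val_eqE /=; lia.
    by rewrite !orbF; have [->|_] := eqVneq k i; rewrite ?orbT ?orbF ?addbF -?val_eqE //=; lia.
  by apply: block2; rewrite /=; lia.
rewrite -autp pE (far l j) in adjl; last by rewrite /=; lia.
have := block_adj_near (a := m) (b := l) adjl; rewrite !inE -!val_eqE /= !eqxx.
by clear -jE ltij lejn lt3n; simpl in *; lia.
Qed.

Lemma all_fixed x : p x = x.
Proof.
elim/ltn_ind: {x}#|x| {-2}x (erefl #|x|) => c IHc x cE.
have [cle2 | clt2] := leqP c 2.
  case: c cE cle2 {IHc} => [/cards0_eq-> // | [/eqP/cards1P[i ->] _ | [|//]]].
    by rewrite fixb ?block1.
  move/eqP/cards2P=> [i [j [neqij ->]]] _.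
  have [ltij | ltji | /val_inj eqij] := ltngtP i j; first exact: pair_fixed.
    by rewrite setUC pair_fixed.
  by rewrite eqij eqxx in neqij.
have [i0 xi0] : exists i0, i0 \in x by apply/card_gt0P; rewrite cE; lia.
(* With [i] minimal and [k] maximal in [x], any third element lies strictly between them, as
   [common_nbr3] requires. *)
case: (@arg_minnP _ i0 (mem x) val xi0) => i xi min_i.
case: (@arg_maxnP _ i0 (mem x) val xi0) => k xk max_k.
have {}xi : i \in x := xi; have {}xk : k \in x := xk.
have [j] : exists j, j \in (x :\ i) :\ k.
  apply/card_gt0P; have := cardsD1 i x; have := cardsD1 k (x :\ i).
  rewrite xi cE => cki ci; move: clt2; rewrite ci cki.
  by case: (k \in x :\ i); case: #|_|.
rewrite !inE -!val_eqE => /and3P[neqjk neqji xj].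
have lts : i < j < k.
  by have := min_i j xj; have := max_k j xj; move: neqjk neqji => /=; lia.
have [ltij ltjk] := andP lts.
have adj a : a \in x -> block_adj (p x) (symdiff x [set a]).
  move=> xa; have sdE : symdiff x [set a] = x :\ a.
    by apply/setP => b; rewrite !inE; case: eqP => [->|]; rewrite ?xa ?addbF.
  have <- : p (symdiff x [set a]) = symdiff x [set a].
    rewrite sdE; apply: (IHc #|x :\ a|) => //.
    by rewrite -cE [X in _ < X](cardsD1 a) xa.
  by rewrite autp block_adj_symdiff block1.
exact: common_nbr3 ltij ltjk (adj i xi) (adj j xj) (adj k xk).
Qed.

End FixedBlocks.

End Rigidity.

(** * Dimension at least four *)

Lemma distinguishing_number_block_adj n :
  3 < n -> distinguishing_number (@block_adj n) = 2.
Proof.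
move=> lt3n; apply: distinguishing_numberE; last first.
  (* One colour fails because complementation is a nontrivial automorphism: it leaves symmetric
     differences unchanged. *)
  apply/existsPn => c; apply: (@not_distinguishing _ _ _ _ (@setC _) set0).
  - exact: setC_inj.
  - move=> x y; congr block; apply/setP => a.
    by rewrite !inE addbN addNb negbK.
  - by move=> x; rewrite !ord1.
  - apply/eqP => /setP/(_ (Ordinal lt3n)).
    by rewrite !inE.
have ltn0 : 0 < n by lia.
have ltn1 : 1 < n by lia.
have ltn2 : 2 < n by lia.
have ltnL : n.-1 < n by lia.
pose o0 := Ordinal ltn0; pose o1 := Ordinal ltn1; pose o2 := Ordinal ltn2.
pose oL := Ordinal ltnL.
pose B : {set {set 'I_n}} := [set set0; [set o0]; [set o1]; [set oL]].
apply/existsP; exists [ffun x => if x \in B then ord0 else ord_max].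
apply/distinguishingP => p autp presp x.
have pB y : (p y \in B) = (y \in B).
  by have := presp y; rewrite !ffunE; do 2 case: ifP.
have BP y : reflect [\/ y = set0, y = [set o0], y = [set o1] | y = [set oL]] (y \in B).
  rewrite !inE -!orbA; apply: (iffP or4P).
    by case=> /eqP->; [apply: Or41 | apply: Or42 | apply: Or43 | apply: Or44].
  by case=> ->; [apply: Or41 | apply: Or42 | apply: Or43 | apply: Or44].
have injp : injective p := perm_inj.
(* The set {n-1} is adjacent to neither {0} nor {1} because n-1 is at least 3. *)
have [||p0 pL p01] := @paw_rigid _ (@block_adj n) p set0 [set o0] [set o1] [set oL]
    (@block_adjC n) (@block_adjxx n) injp autp.
- rewrite !block_adj0 !block1 !block_adj1 -!val_eqE /=; split=> //.
  by apply/andP; split; lia.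
- by move=> y /BP; rewrite -pB => /BP.
have fix0 : p [set o0] = [set o0].
  case: p01 => -[p0E p1E] //; exfalso.
  by apply: (@no_swap n p injp autp p0 o0 o1 o2 _ p0E p1E).
apply: (all_fixed injp autp p0 lt3n) => y.
apply: (block_fixed injp autp p0 (erefl : o0 = 0 :> nat) _ fix0 pL).
by rewrite /= prednK.
Qed.

(** * Dimension three *)

Definition cube3 := (bool * bool * bool)%type.

(* AQ_3 is the join of two copies of 2K_2: the first coordinate selects the
   copy, the second one the edge in it, the third one the endpoint. *)
Definition join2K2 : rel cube3 := fun x y =>
  (x.1.1 != y.1.1) || (x.1.2 == y.1.2) && (x.2 != y.2).

(** All four words of odd weight are connection vectors, so parity selects the copy; the only even
    one is 011, which keeps [a 0] and flips [a 1]. *)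
Definition join_coord (u : 3.-tuple bool) : cube3 :=
  let a := nth false u in (a 0 (+) a 1 (+) a 2, a 0, a 1).

Lemma join_coord_bij : bijective join_coord.
Proof.
exists (fun x => [tuple x.1.2; x.2; x.1.1 (+) x.1.2 (+) x.2]).
  case/tupleP=> a u; case/tupleP: u => b u; case/tupleP: u => c u; rewrite (tuple0 u).
  by apply: val_inj; case: a; case: b; case: c.
by case=> [[[] []] []].
Qed.

Lemma join_coord_mono : {mono join_coord : u v / AQ u v >-> join2K2 u v}.
Proof.
case/tupleP=> a u; case/tupleP: u => b u; case/tupleP: u => c u; rewrite (tuple0 u).
case/tupleP=> a' v; case/tupleP: v => b' v; case/tupleP: v => c' v; rewrite (tuple0 v).
rewrite !AQ_cons -!val_eqE /=.
by case: a; case: b; case: c; case: a'; case: b'; case: c'.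
Qed.

(* The edges of one copy are coloured {0,1} and {0,2}, those of the other one
   {0,1} and {1,2}. *)
Definition edge_color (x : cube3) : nat :=
  if x.1.2 then (if x.2 then 2 else x.1.1) else x.2.

Definition cube3_enum : seq cube3 :=
  [seq (ht, b) | ht <- [seq (h, t) | h <- [:: false; true], t <- [:: false; true]],
                 b <- [:: false; true]].

Lemma mem_cube3_enum x : x \in cube3_enum.
Proof. by case: x => [[[] []] []]. Qed.

(** Candidate image lists under colour-preserving maps. The colour classes have sizes 3, 3 and 2,
    leaving 2916 lists for the eight vertices, few enough to enumerate. *)
Fixpoint color_images (s : seq cube3) : seq (seq cube3) :=
  if s is x :: s' then
    [seq y :: l | y <- [seq y <- cube3_enum | edge_color y == edge_color x],
                  l <- color_images s']
  else [:: [::]].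

Lemma map_color_images p s :
  (forall x, edge_color (p x) = edge_color x) -> map p s \in color_images s.
Proof.
move=> presp; elim: s => // x s IHs; apply: allpairs_f IHs.
by rewrite mem_filter presp eqxx mem_cube3_enum.
Qed.

Definition adj_table (s : seq cube3) := [seq join2K2 x y | x <- s, y <- s].

(** Decided by enumeration. Conceptually, the ends of each edge of a copy differ in colour, the two
    edges of a copy have different colour pairs, and the copies have different sets of pairs. *)
Lemma edge_color_rigid :
  all (fun s => uniq s && (adj_table s == adj_table cube3_enum) ==> (s == cube3_enum))
      (color_images cube3_enum).
Proof. by vm_compute. Qed.

Lemma join2K2_color3 : has_distinguishing_coloring join2K2 3.
Proof.
apply/existsP; exists [ffun x => inord (edge_color x)].
apply/distinguishingP => p autp presp.
have lt3 x : edge_color x < 3 by case: x => [[[] []] []].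
have {}presp x : edge_color (p x) = edge_color x.
  by have := presp x; rewrite !ffunE => /(congr1 val); rewrite /= !inordK.
have /allP/(_ _ (map_color_images cube3_enum presp))/implyP := edge_color_rigid.
rewrite (map_inj_uniq perm_inj) (isT : uniq cube3_enum) andTb => pE x.
suff /eqP : map p cube3_enum == cube3_enum.
  by rewrite -[RHS]map_id => /eq_in_map; apply; exact: mem_cube3_enum.
apply: pE; rewrite /adj_table allpairs_mapl allpairs_mapr.
by apply/eqP/eq_allpairs => y z; exact: autp.
Qed.

Lemma join2K2_color2 : ~~ has_distinguishing_coloring join2K2 2.
Proof.
apply/existsPn => c; pose d x := c x == ord0.
have cE x y : d x = d y -> c x = c y.
  rewrite /d; case: (c x) => -[|[|//]] ?; case: (c y) => -[|[|//]] ? //= _;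
  exact: val_inj.
have [/existsP[[h t] /eqP mono] | /existsPn poly] :=
    boolP [exists ht : bool * bool, d (ht, false) == d (ht, true)].
  pose f (x : cube3) : cube3 := (x.1, x.2 (+) (x.1 == (h, t))).
  apply: (@not_distinguishing _ _ _ _ f ((h, t), false)).
  - by apply: inv_inj => -[ht b]; rewrite /f /= -addbA addbb addbF.
  - move=> [[h1 t1] b1] [[h2 t2] b2]; rewrite /f /join2K2 /=.
    by case: h t {mono f} => -[]; case: h1; case: t1; case: b1; case: h2; case: t2; case: b2.
  - move=> [ht b]; apply: cE; rewrite /f /=; case: eqP => [->|_]; last by rewrite addbF.
    by case: b; rewrite /= mono.
  - by apply/eqP; rewrite /f /= !eqxx.
(* Every edge inside a copy now carries both colours. Exchanging the two edges of the copy [false]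
   preserves colours after a twist by [s], which records whether their [false] ends differ in
   colour. *)
pose s := d (false, false, false) (+) d (false, true, false).
pose f (x : cube3) : cube3 :=
  if x.1.1 then x else (false, ~~ x.1.2, x.2 (+) s).
apply: (@not_distinguishing _ _ _ _ f (false, false, false)).
- by apply: inv_inj => -[[[] t] b]; rewrite /f //= negbK -addbA addbb addbF.
- move=> [[h1 t1] b1] [[h2 t2] b2]; rewrite /f /join2K2 /=.
  by case: (s); case: h1; case: t1; case: b1; case: h2; case: t2; case: b2.
- move=> [[h t] b]; apply: cE; rewrite /f /=; case: h => //=.
  have := poly (false, false); have := poly (false, true); rewrite /s.
  by case: t; case: b => /=; case E1: (d (false, false, false));
    case E2: (d (false, true, false)); case E3: (d (false, false, true));
    case E4: (d (false, true, true)).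
- by rewrite /f.
Qed.

Theorem theorem3p3 (n : nat) (hn : 1 <= n) :
  distinguishing_number (@AQ n) =
    if n == 1 then 2 else if n == 2 then 4 else if n == 3 then 3 else 2.
Proof.
have cardE m : 0 < #|{: m.-tuple bool}| by rewrite card_tuple card_bool expn_gt0.
case: n hn => [|[|[|[|n]]]] // _.
- by rewrite distinguishing_number_complete // card_tuple card_bool.
- rewrite distinguishing_number_complete //; first by rewrite card_tuple card_bool.
  case/tupleP=> a u; case/tupleP: u => b u; rewrite (tuple0 u).
  case/tupleP=> a' v; case/tupleP: v => b' v; rewrite (tuple0 v).
  rewrite AQ_cons -!val_eqE /=.
  by case: a; case: b; case: a'; case: b'.
- rewrite (distinguishing_number_iso join_coord_bij join_coord_mono).
  exact: distinguishing_numberE join2K2_color3 join2K2_color2.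
- rewrite (distinguishing_number_iso (@gray_bij _) (@gray_block_adj _)).
  exact: distinguishing_number_block_adj.
Qed.
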